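(* For all integers $m,n,p\ge0$, in $\tilde{\mathfrak S}_{m+n+p}$ one has $$j_{n,m+p}(1,\tilde\tau_{m,p})\;j_{n+m,p}(\tilde\tau_{m,n},1)=\tilde\tau_{m,n+p}.$$
   Context: $\tilde{\mathfrak S}_n$ (the spin-symmetric group) is the group generated by $\tilde s_1,\dots,\tilde s_{n-1},c$ subject to: $c$ is central and $c^2=1$; $\tilde s_i^2=1$; $\tilde s_i\tilde s_{i+1}\tilde s_i=\tilde s_{i+1}\tilde s_i\tilde s_{i+1}$ for $1\le i\le n-2$; $\tilde s_i\tilde s_j=c\,\tilde s_j\tilde s_i$ for $|i-j|\ge2$. In $\tilde{\mathfrak S}_{n+m}$ put $\tilde\sigma_{n,i}=\tilde s_i\tilde s_{i+1}\cdots\tilde s_{i+n-1}$ and $\tilde\tau_{n,m}=\tilde\sigma_{n,m}\tilde\sigma_{n,m-1}\cdots\tilde\sigma_{n,1}$. For $g\in\tilde{\mathfrak S}_n$, $h\in\tilde{\mathfrak S}_m$ put $j_{n,m}(g,h)=\iota_1(g)\iota_2(h)\in\tilde{\mathfrak S}_{n+m}$, where $\iota_1,\iota_2$ are the homomorphisms $\tilde{\mathfrak S}_n\to\tilde{\mathfrak S}_{n+m}$, $\tilde{\mathfrak S}_m\to\tilde{\mathfrak S}_{n+m}$ with $\iota_1(\tilde s_i)=\tilde s_i$, $\iota_2(\tilde s_i)=\tilde s_{n+i}$, and $c\mapsto c$. *)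

(* Defs.v *)
From HB Require Import structures.
From mathcomp Require Import all_boot.
From mathcomp Require Import boolp.

Set Implicit Arguments.
Unset Strict Implicit.
Unset Printing Implicit Defensive.

Local Open Scope group_scope.
Local Open Scope quotient_scope.

Section Presentation.
Variable I : choiceType.

(* (a, true) stands for the generator a and (a, false) for its formal inverse *)
Definition word := seq (I * bool).
Definition letter (a : I) : I * bool := (a, true).
Definition flip (x : I * bool) : I * bool := (x.1, ~~ x.2).
Definition word_inv (w : word) : word := rev (map flip w).

Section Group.
Variable R : word -> word -> Prop.

Inductive pres_cong : word -> word -> Prop :=
| pres_refl u : pres_cong u u
| pres_sym u v : pres_cong u v -> pres_cong v u
| pres_trans u v w : pres_cong u v -> pres_cong v w -> pres_cong u w
| pres_cat u u' v v' :
    pres_cong u u' -> pres_cong v v' -> pres_cong (u ++ v) (u' ++ v')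
| pres_cancel x : pres_cong [:: x; flip x] [::]
| pres_rel u v : R u v -> pres_cong u v.

Definition pres_congb (u v : word) : bool := `[< pres_cong u v >].

Lemma pres_congb_refl : reflexive pres_congb.
Proof. by move=> u; apply/asboolP; exact: pres_refl. Qed.

Lemma pres_congb_sym : symmetric pres_congb.
Proof. by move=> u v; apply/asboolP/asboolP => /pres_sym. Qed.

Lemma pres_congb_trans : transitive pres_congb.
Proof.
move=> v u w /asboolP uv /asboolP vw; apply/asboolP; exact: pres_trans uv vw.
Qed.

Canonical pres_equiv :=
  EquivRel pres_congb pres_congb_refl pres_congb_sym pres_congb_trans.

(* the group < I | u = v for all u, v with R u v > *)
Definition pres : Type := {eq_quot pres_equiv}.
HB.instance Definition _ := Choice.on pres.

Definition pres_class (w : word) : pres := \pi_({eq_quot pres_equiv}) w.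
Definition pres_repr (x : pres) : word := repr (x : {eq_quot pres_equiv}).

Lemma pres_reprK : cancel pres_repr pres_class.
Proof. by move=> x; rewrite /pres_class /pres_repr reprK. Qed.

Lemma pres_classP u v : pres_class u = pres_class v <-> pres_cong u v.
Proof.
split; first by move/eqmodP => /asboolP.
by move=> uv; apply/eqmodP/asboolP.
Qed.

Lemma pres_classK w : pres_cong (pres_repr (pres_class w)) w.
Proof. by apply/pres_classP; rewrite pres_reprK. Qed.

Definition pres_one : pres := pres_class [::].
Definition pres_mul (x y : pres) : pres :=
  pres_class (pres_repr x ++ pres_repr y).
Definition pres_inv (x : pres) : pres := pres_class (word_inv (pres_repr x)).

Lemma pres_mul_class u v :
  pres_mul (pres_class u) (pres_class v) = pres_class (u ++ v).
Proof. by apply/pres_classP; apply: pres_cat; exact: pres_classK. Qed.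

Lemma flipK : involutive flip.
Proof. by case=> a b; rewrite /flip /= negbK. Qed.

Lemma word_invK : involutive word_inv.
Proof. by move=> w; rewrite /word_inv map_rev revK mapK //; exact: flipK. Qed.

Lemma pres_congV w : pres_cong (w ++ word_inv w) [::].
Proof.
elim: w => [|x w IH]; first exact: pres_refl.
rewrite /word_inv /= rev_cons -cats1 catA -/(word_inv w).
apply: pres_trans (pres_cancel x).
apply: (@pres_cat [:: x] [:: x] _ [:: flip x]); first exact: pres_refl.
by apply: (@pres_cat _ [::] _ [:: flip x]) => //; exact: pres_refl.
Qed.

Lemma pres_mulA : associative pres_mul.
Proof.
move=> x y z; rewrite -(pres_reprK x) -(pres_reprK y) -(pres_reprK z).
by rewrite !pres_mul_class catA.
Qed.

Lemma pres_mul1 : left_id pres_one pres_mul.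
Proof. by move=> x; rewrite -(pres_reprK x) pres_mul_class. Qed.

Lemma pres_mulr1 : right_id pres_one pres_mul.
Proof. by move=> x; rewrite -(pres_reprK x) pres_mul_class cats0. Qed.

Lemma pres_mulV : left_inverse pres_one pres_inv pres_mul.
Proof.
move=> x; rewrite -{2}(pres_reprK x) pres_mul_class; apply/pres_classP.
by rewrite -{2}(word_invK (pres_repr x)); exact: pres_congV.
Qed.

Lemma pres_mulrV : right_inverse pres_one pres_inv pres_mul.
Proof.
move=> x; rewrite -{1}(pres_reprK x) pres_mul_class; apply/pres_classP.
exact: pres_congV.
Qed.

HB.instance Definition _ :=
  isGroup.Build pres pres_mulA pres_mul1 pres_mulr1 pres_mulV pres_mulrV.

Definition pres_gen (a : I) : pres := pres_class [:: letter a].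

End Group.

Section Lift.
Variables (G : groupType) (f : I -> G).

Definition word_eval (w : word) : G :=
  \prod_(x <- w) (if x.2 then f x.1 else (f x.1)^-1).

Lemma word_eval_cat u v : word_eval (u ++ v) = word_eval u * word_eval v.
Proof. exact: big_cat. Qed.

(* When f respects R, this is the homomorphism pres R -> G extending f;
   see pres_liftM and pres_lift_gen. *)
Definition pres_lift (R : word -> word -> Prop) (x : pres R) : G :=
  word_eval (pres_repr x).

Variable R : word -> word -> Prop.
Hypothesis fR : forall u v, R u v -> word_eval u = word_eval v.

Lemma word_eval_cong u v : pres_cong R u v -> word_eval u = word_eval v.
Proof.
elim=> {u v} // [u v w _ -> _ -> //|u u' v v' _ eu _ ev|[a b]].
  by rewrite !word_eval_cat eu ev.
rewrite /word_eval !big_cons !big_nil mulg1 /=.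
by case: b; rewrite /= ?mulgV ?mulVg.
Qed.

Lemma pres_liftM : {morph (@pres_lift R) : x y / x * y}.
Proof.
move=> x y; rewrite /pres_lift -word_eval_cat.
exact/word_eval_cong/pres_classK.
Qed.

Lemma pres_lift_gen a : pres_lift (pres_gen R a) = f a.
Proof.
rewrite /pres_lift (word_eval_cong (pres_classK _ _)).
by rewrite /word_eval big_seq1.
Qed.

End Lift.
End Presentation.

(* the generators of the spin-symmetric group: None is c and Some i is s_i *)
Definition spin_gens (n : nat) : choiceType :=
  option {i : nat | (0 < i < n)%N}.

Section SpinRelations.
Variable n : nat.
Let c := letter (None : spin_gens n).
Let s (i : {i : nat | (0 < i < n)%N}) := letter (Some i : spin_gens n).

Inductive spin_rel : word (spin_gens n) -> word (spin_gens n) -> Prop :=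
| spin_central i : spin_rel [:: c; s i] [:: s i; c]
| spin_cc : spin_rel [:: c; c] [::]
| spin_ss i : spin_rel [:: s i; s i] [::]
| spin_braid i j : val j = (val i).+1 ->
    spin_rel [:: s i; s j; s i] [:: s j; s i; s j]
| spin_far i j : ((val i).+2 <= val j)%N || ((val j).+2 <= val i)%N ->
    spin_rel [:: s i; s j] [:: c; s j; s i].
End SpinRelations.

Definition spin (n : nat) : Type := pres (@spin_rel n).
HB.instance Definition _ n := Group.on (spin n).

Definition spin_c (n : nat) : spin n := pres_gen (@spin_rel n) None.

(* s_i, with the junk value 1 when i is not in 1, ..., n-1 *)
Definition spin_s (n i : nat) : spin n :=
  if insub i is Some k then pres_gen (@spin_rel n) (Some k) else 1.

Lemma spin_s_gen n (i : {i : nat | (0 < i < n)%N}) :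
  spin_s n (val i) = pres_gen (@spin_rel n) (Some i).
Proof. by rewrite /spin_s valK. Qed.

Lemma spin_genM n (a b : spin_gens n) :
  pres_gen (@spin_rel n) a * pres_gen (@spin_rel n) b =
  pres_class (@spin_rel n) [:: letter a; letter b].
Proof. exact: pres_mul_class. Qed.

Lemma spin_genMM n (a b d : spin_gens n) :
  pres_gen (@spin_rel n) a * (pres_gen (@spin_rel n) b *
    pres_gen (@spin_rel n) d) =
  pres_class (@spin_rel n) [:: letter a; letter b; letter d].
Proof. by rewrite spin_genM; exact: pres_mul_class. Qed.

Lemma spin_ccE n : spin_c n * spin_c n = 1.
Proof. by rewrite spin_genM; apply/pres_classP/pres_rel; constructor. Qed.

Lemma spin_csE n i : spin_c n * spin_s n i = spin_s n i * spin_c n.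
Proof.
rewrite /spin_s; case: insubP => [k _ _|_]; last by rewrite mulg1 mul1g.
by rewrite !spin_genM; apply/pres_classP/pres_rel; constructor.
Qed.

Lemma spin_ssE n i : spin_s n i * spin_s n i = 1.
Proof.
rewrite /spin_s; case: insubP => [k _ _|_]; last by rewrite mulg1.
by rewrite spin_genM; apply/pres_classP/pres_rel; constructor.
Qed.

Lemma spin_braidE n i : (0 < i)%N -> (i.+1 < n)%N ->
  spin_s n i * (spin_s n i.+1 * spin_s n i) =
  spin_s n i.+1 * (spin_s n i * spin_s n i.+1).
Proof.
move=> i0 iN.
have hi : (0 < i < n)%N by rewrite i0 ltnW.
rewrite -[i]/(val (Sub i hi : {i : nat | (0 < i < n)%N})).
rewrite -[(val _).+1]/(val (Sub i.+1 iN : {i : nat | (0 < i < n)%N})).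
rewrite !spin_s_gen !spin_genMM; apply/pres_classP/pres_rel.
exact: spin_braid.
Qed.

Lemma spin_farE n i j : (0 < i < n)%N -> (0 < j < n)%N ->
  (i.+2 <= j)%N || (j.+2 <= i)%N ->
  spin_s n i * spin_s n j = spin_c n * (spin_s n j * spin_s n i).
Proof.
move=> hi hj ij.
rewrite -[i]/(val (Sub i hi : {i : nat | (0 < i < n)%N})).
rewrite -[j]/(val (Sub j hj : {i : nat | (0 < i < n)%N})).
rewrite !spin_s_gen spin_genM spin_genMM; apply/pres_classP/pres_rel.
exact: spin_far.
Qed.

(* the homomorphism s_i |-> s_(k+i), c |-> c, meaningful when k + n <= N *)
Definition spin_shift (k n N : nat) : spin n -> spin N :=
  pres_lift (fun a : spin_gens n =>
    if a is Some i then spin_s N (k + val i) else spin_c N) (R := @spin_rel n).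

Section ShiftTheory.
Variables (k n N : nat) (knN : (k + n <= N)%N).

Let shift_bound (i : {i : nat | (0 < i < n)%N}) : (0 < k + val i < N)%N.
Proof.
case: i => i /= /andP[i0 iN]; rewrite (leq_trans i0 (leq_addl _ _)) /=.
by rewrite (leq_trans _ knN) // ltn_add2l.
Qed.

Lemma spin_shift_rel u v : spin_rel u v ->
  let f := fun a : spin_gens n =>
    if a is Some i then spin_s N (k + val i) else spin_c N in
  word_eval f u = word_eval f v.
Proof.
case=> [i||i|i j ij|i j ij] /=; rewrite /word_eval !big_cons !big_nil /= !mulg1.
- exact: spin_csE.
- exact: spin_ccE.
- exact: spin_ssE.
- rewrite ij addnS spin_braidE //; first by case/andP: (shift_bound i).
  by rewrite -addnS -ij; case/andP: (shift_bound j).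
- by apply: spin_farE; rewrite ?shift_bound // -!addnS !leq_add2l.
Qed.

Lemma spin_shiftM : {morph (@spin_shift k n N) : x y / x * y}.
Proof. exact: pres_liftM spin_shift_rel. Qed.

Lemma spin_shift_c : spin_shift k N (spin_c n) = spin_c N.
Proof. exact: pres_lift_gen spin_shift_rel _. Qed.

Lemma spin_shift_s i :
  (0 < i < n)%N -> spin_shift k N (spin_s n i) = spin_s N (k + i).
Proof.
move=> hi; rewrite -[i]/(val (Sub i hi : {i : nat | (0 < i < n)%N})).
rewrite spin_s_gen; exact: pres_lift_gen spin_shift_rel _.
Qed.

End ShiftTheory.

Definition spin_iota1 (n m : nat) : spin n -> spin (n + m) :=
  @spin_shift 0 n (n + m).
Definition spin_iota2 (n m : nat) : spin m -> spin (n + m) :=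
  @spin_shift n m (n + m).

Lemma spin_iota1M n m : {morph (@spin_iota1 n m) : x y / x * y}.
Proof. exact/spin_shiftM/leq_addr. Qed.
HB.instance Definition _ n m :=
  isMultiplicative.Build _ _ (@spin_iota1 n m) (@spin_iota1M n m).

Lemma spin_iota2M n m : {morph (@spin_iota2 n m) : x y / x * y}.
Proof. exact: spin_shiftM. Qed.
HB.instance Definition _ n m :=
  isMultiplicative.Build _ _ (@spin_iota2 n m) (@spin_iota2M n m).

Lemma spin_iota1_c n m : spin_iota1 m (spin_c n) = spin_c (n + m).
Proof. exact/spin_shift_c/leq_addr. Qed.

Lemma spin_iota2_c n m : spin_iota2 n (spin_c m) = spin_c (n + m).
Proof. exact: spin_shift_c. Qed.

Lemma spin_iota1_s n m i :
  (0 < i < n)%N -> spin_iota1 m (spin_s n i) = spin_s (n + m) i.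
Proof. by apply: spin_shift_s; exact: leq_addr. Qed.

Lemma spin_iota2_s n m i :
  (0 < i < m)%N -> spin_iota2 n (spin_s m i) = spin_s (n + m) (n + i).
Proof. exact: spin_shift_s. Qed.

Definition spin_j (n m : nat) (g : spin n) (h : spin m) : spin (n + m) :=
  spin_iota1 m g * spin_iota2 n h.

Definition spin_sigma (n m i : nat) : spin (n + m) :=
  \prod_(i <= k < i + n) spin_s (n + m) k.

(* the factors are taken in the order i = m, m - 1, ..., 1 *)
Definition spin_tau (n m : nat) : spin (n + m) :=
  \prod_(i <- rev (iota 1 m)) spin_sigma n m i.

(* the identity map between the groups of equal (but not convertible) ranks *)
Definition spin_cast (n m : nat) (e : n = m) (x : spin n) : spin m :=
  ecast k (spin k) e x.

Lemma addn_swapl (m n p : nat) : (n + m + p = m + n + p)%N.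
Proof. by rewrite (addnC n). Qed.

Lemma addn_rotl (m n p : nat) : (n + (m + p) = m + n + p)%N.
Proof. by rewrite addnA addn_swapl. Qed.

(* Main.v *)
(* The factors [sigma_(m,i)] of [tau_(m,n+p)] are taken in the order
   [i = n + p, ..., 1]. Those with [i > n] form the image of [tau_(m,p)] under
   the shift by [n], and those with [i <= n] form the image of [tau_(m,n)] under
   the shift by [0]; no relation of the spin-symmetric group is used. *)
Require Import Defs.
From mathcomp Require Import all_boot.

Local Open Scope group_scope.

(** The rank [N] is independent of [m] and [s], so that a cast changes [N] alone and products from
    different groups become comparable. *)
Definition sigma_prod (N m : nat) (s : seq nat) : spin N :=
  \prod_(i <- s) \prod_(i <= k < i + m) spin_s N k.

Lemma spin_tauE m q : spin_tau m q = sigma_prod (m + q) m (rev (iota 1 q)).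
Proof. by []. Qed.

Lemma spin_cast_sigma_prod N N' (e : N = N') m s :
  spin_cast e (sigma_prod N m s) = sigma_prod N' m s.
Proof. by case: N' / e. Qed.

Lemma sigma_prod_cat N m s t :
  sigma_prod N m (s ++ t) = sigma_prod N m s * sigma_prod N m t.
Proof. exact: big_cat. Qed.

Lemma spin_shift1 k n N : (k + n <= N)%N -> @spin_shift k n N 1 = 1.
Proof.
move=> knN; apply: (mulgI (spin_shift k N (1 : spin n))).
by rewrite -spin_shiftM // !mulg1.
Qed.

(** The shift moves each start [i] to [k + i]; [m + q <= N] keeps every index below [N], away from
    the junk value of [spin_s]. *)
Lemma spin_shift_sigma_prod k N N' m q : (k + N <= N')%N -> (m + q <= N)%N ->
  spin_shift k N' (sigma_prod N m (rev (iota 1 q))) =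
  sigma_prod N' m (rev (iota k.+1 q)).
Proof.
move=> kN mqN; have f1 := spin_shift1 _ _ _ kN; have fM := spin_shiftM kN.
rewrite /sigma_prod (big_morph _ fM f1) -[k.+1]addn1 iotaDl -map_rev big_map.
rewrite [LHS]big_seq [RHS]big_seq; apply: eq_bigr => i; rewrite mem_rev mem_iota => /andP[i0 iq].
rewrite (big_morph _ fM f1) -addnA ![(k + _)%N]addnC big_addn.
rewrite addnK !big_nat.
apply: eq_bigr => l /andP[il lim].
rewrite spin_shift_s ?[(l + k)%N]addnC // (leq_trans i0 il) /=.
rewrite (leq_trans lim) // (leq_trans _ mqN) // [(m + q)%N]addnC leq_add2r.
by rewrite -ltnS.
Qed.

Theorem proposition5p6 (m n p : nat) :
  (spin_cast (addn_rotl m n p) (spin_j (n := n) (m := m + p) 1 (spin_tau m p)) *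
   spin_cast (addn_swapl m n p)
     (spin_j (n := n + m) (m := p) (spin_cast (addnC m n) (spin_tau m n)) 1))%g =
  spin_cast (addnA m n p) (spin_tau m (n + p)).
Proof.
rewrite /spin_j /spin_iota1 /spin_iota2 !spin_shift1 ?leq_addr // mul1g mulg1.
rewrite !spin_tauE !spin_cast_sigma_prod !spin_shift_sigma_prod //.
(* Reversing [iota 1 n ++ iota n.+1 p] puts the indices above [n] first. *)
- by rewrite !spin_cast_sigma_prod -sigma_prod_cat -rev_cat -iotaD.
- by rewrite add0n leq_addr.
- by rewrite addnC.
Qed.
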